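(* Let $A=\Bbbk[u]/(u^2-1)$ and let $\gamma\in\Bbbk$ be nonzero. Fix the $T_2(-1)$-module algebra structure on $A$ given by $$g\cdot u=-u,\qquad x\cdot u=\gamma 1_A .$$ Then, for any $\delta\in\Bbbk$, by defining $$G\cdot u=-u,\qquad X\cdot u=\delta 1_A,$$ $A$ becomes a $D(T_2(-1))$-module algebra. Moreover, all extensions of the given action of $T_2(-1)$ on $A$ to an action of $D(T_2(-1))$ making $A$ a $D(T_2(-1))$-module algebra are of this form.
   Context: $\Bbbk$ is an algebraically closed field of characteristic $0$. For grouplike elements $g,h$ of a Hopf algebra, an element $c$ is $(g,h)$-skew primitive if $\Delta(c)=g\otimes c+c\otimes h$. For a Hopf algebra $H$, an $H$-module algebra is an algebra $A$ that is a left $H$-module with $h\cdot(ab)=(h_{(1)}\cdot a)(h_{(2)}\cdot b)$ and $h\cdot 1_A=\epsilon(h)1_A$. The Sweedler Hopf algebra $T_2(-1)$ is generated by a grouplike element $g$ and a $(g,1)$-skew primitive element $x$ subject to $g^2=1$, $x^2=0$, $gx=-xg$. Its Drinfel'd double $D(T_2(-1))$ is the Hopf algebra generated by grouplike elements $g,G$, a $(g,1)$-skew primitive element $x$ and a $(1,G)$-skew primitive element $X$, subject to $$g^2=G^2=1,\quad x^2=X^2=0,\quad gx=-xg,\quad GX=-XG,\quad gG=Gg,\quad xG=-Gx,\quad gX=-Xg,\quad xX=Xx+G-g;$$ it contains $T_2(-1)$ as the Hopf subalgebra generated by $g,x$. An extension of an action of $T_2(-1)$ on $A$ is an action of $D(T_2(-1))$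 making $A$ a $D(T_2(-1))$-module algebra and restricting to the given action of $T_2(-1)$. *)

(* Defs.v *)
From HB Require Import structures.
From mathcomp Require Import all_boot all_order all_algebra.
From mathcomp Require Import qpoly.
From mathcomp Require Import boolp.

Set Implicit Arguments.
Unset Strict Implicit.
Unset Printing Implicit Defensive.

Import GRing.Theory.
Local Open Scope ring_scope.

(* Tensors: an element of U (x) V is represented by a finite list of pure    *)
(* tensors, and two lists denote the same tensor iff no bilinear map         *)
(* separates them (universal property of U (x) V).                           *)

Notation bilinear_map f := (bilinear_for *:%R *:%R f).

Section Tensor.
Variable k : fieldType.

Definition tensor (U V : lmodType k) := seq (U * V).

Definition tapp (U V W : lmodType k) (f : U -> V -> W) (t : tensor U V) : W :=
  \sum_(p <- t) f p.1 p.2.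

Definition teq (U V : lmodType k) (s t : tensor U V) : Prop :=
  forall (W : lmodType k) (f : U -> V -> W),
    bilinear_map f -> tapp f s = tapp f t.

Definition tscale (U V : lmodType k) (a : k) (t : tensor U V) : tensor U V :=
  [seq (a *: p.1, p.2) | p <- t].

Definition tmul (A B : algType k) (s t : tensor A B) : tensor A B :=
  [seq (p.1 * q.1, p.2 * q.2) | p <- s, q <- t].

End Tensor.

(* Equality in a triple tensor product is tested on trilinear maps.          *)
Definition trilinear_map (k : fieldType) (U V V' W : lmodType k)
    (f : U -> V -> V' -> W) : Prop :=
  (forall a, bilinear_map (f a)) /\ (forall b c, linear (fun a => f a b c)).

Record hopfAlg (k : fieldType) := HopfAlg {
  hopf_alg :> algType k;
  comul : hopf_alg -> tensor hopf_alg hopf_alg;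
  counit : hopf_alg -> k;
  antipode : hopf_alg -> hopf_alg;
  comulP : forall (a : k) (x y : hopf_alg),
    teq (comul (a *: x + y)) (tscale a (comul x) ++ comul y);
  comul1 : teq (comul 1) [:: (1, 1)];
  comulM : forall x y : hopf_alg,
    teq (comul (x * y)) (tmul (comul x) (comul y));
  counitP : forall (a : k) (x y : hopf_alg),
    counit (a *: x + y) = a * counit x + counit y;
  counit1 : counit 1 = 1;
  counitM : forall x y : hopf_alg, counit (x * y) = counit x * counit y;
  antipodeP : forall (a : k) (x y : hopf_alg),
    antipode (a *: x + y) = a *: antipode x + antipode y;
  comulA : forall (h : hopf_alg) (W : lmodType k)
      (f : hopf_alg -> hopf_alg -> hopf_alg -> W),
    trilinear_map f ->
    \sum_(p <- comul h) \sum_(q <- comul p.1) f q.1 q.2 p.2 =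
    \sum_(p <- comul h) \sum_(q <- comul p.2) f p.1 q.1 q.2;
  counitl : forall h : hopf_alg, \sum_(p <- comul h) counit p.1 *: p.2 = h;
  counitr : forall h : hopf_alg, \sum_(p <- comul h) counit p.2 *: p.1 = h;
  antipodel : forall h : hopf_alg,
    \sum_(p <- comul h) antipode p.1 * p.2 = (counit h)%:A;
  antipoder : forall h : hopf_alg,
    \sum_(p <- comul h) p.1 * antipode p.2 = (counit h)%:A
}.

Definition grouplike (k : fieldType) (H : hopfAlg k) (g : H) : Prop :=
  g != 0 /\ teq (comul g) [:: (g, g)].

Definition skew_primitive (k : fieldType) (H : hopfAlg k) (g h c : H) : Prop :=
  teq (comul c) [:: (g, c); (c, h)].

Record module_algebra (k : fieldType) (H : hopfAlg k) (A : algType k)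
    (act : H -> A -> A) : Prop := ModuleAlgebra {
  act_bilinear : bilinear_map act;
  act1 : forall a, act 1 a = a;
  actM : forall h h' a, act (h * h') a = act h (act h' a);
  act_mul : forall h a b,
    act h (a * b) = \sum_(p <- comul h) act p.1 a * act p.2 b;
  act_one : forall h, act h 1 = (counit h)%:A
}.

(* Algebras presented by generators and relations: noncommutative polynomial *)
(* expressions in the generators, modulo the least congruence containing the *)
(* algebra axioms and the relations.                                         *)

Inductive term (k I : Type) : Type :=
  | Gen of I
  | Scal of k
  | Add of term k I & term k I
  | Mul of term k I & term k I.
Arguments Gen {k I}.
Arguments Scal {k I}.

HB.instance Definition _ (k I : Type) := gen_eqMixin (term k I).
HB.instance Definition _ (k I : Type) := gen_choiceMixin (term k I).

Declare Scope pterm_scope.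
Delimit Scope pterm_scope with PT.
Bind Scope pterm_scope with term.
Notation "s + t" := (Add s t) : pterm_scope.
Notation "s * t" := (Mul s t) : pterm_scope.
Notation "- s" := (Mul (Scal (-1)%R) s) : pterm_scope.
Notation "s - t" := (Add s (- t)%PT) : pterm_scope.
Notation "0" := (Scal 0%R) : pterm_scope.
Notation "1" := (Scal 1%R) : pterm_scope.

Inductive congr_closure (k : fieldType) (I : Type)
    (rel : term k I -> term k I -> Prop) : term k I -> term k I -> Prop :=
  | cc_rel s t : rel s t -> congr_closure rel s t
  | cc_refl s : congr_closure rel s s
  | cc_sym s t : congr_closure rel s t -> congr_closure rel t s
  | cc_trans s t u :
      congr_closure rel s t -> congr_closure rel t u -> congr_closure rel s u
  | cc_add s s' t t' : congr_closure rel s s' -> congr_closure rel t t' ->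
      congr_closure rel (s + t)%PT (s' + t')%PT
  | cc_mul s s' t t' : congr_closure rel s s' -> congr_closure rel t t' ->
      congr_closure rel (s * t)%PT (s' * t')%PT
  | cc_addA s t u : congr_closure rel (s + (t + u))%PT (s + t + u)%PT
  | cc_addC s t : congr_closure rel (s + t)%PT (t + s)%PT
  | cc_add0 s : congr_closure rel (0 + s)%PT s
  | cc_addN s : congr_closure rel (- s + s)%PT 0%PT
  | cc_mulA s t u : congr_closure rel (s * (t * u))%PT (s * t * u)%PT
  | cc_mul1l s : congr_closure rel (1 * s)%PT s
  | cc_mul1r s : congr_closure rel (s * 1)%PT s
  | cc_mulDl s t u : congr_closure rel ((s + t) * u)%PT (s * u + t * u)%PT
  | cc_mulDr s t u : congr_closure rel (s * (t + u))%PT (s * t + s * u)%PT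
  | cc_scalD a b : congr_closure rel (Scal (a + b)) (Scal a + Scal b)%PT
  | cc_scalM a b : congr_closure rel (Scal (a * b)) (Scal a * Scal b)%PT
  | cc_scalC a s : congr_closure rel (Scal a * s)%PT (s * Scal a)%PT.

Fixpoint teval (k : fieldType) (I : Type) (B : algType k) (f : I -> B)
    (t : term k I) : B :=
  match t with
  | Gen i => f i
  | Scal c => c%:A
  | Add s t => teval f s + teval f t
  | Mul s t => teval f s * teval f t
  end.

Definition respects (k : fieldType) (I : Type)
    (rel : term k I -> term k I -> Prop) (B : algType k) (f : I -> B) : Prop :=
  forall s t, rel s t -> teval f s = teval f t.

(* MathComp algebras are nontrivial; the augmentation, which will be the     *)
(* counit, shows that the presented algebra is.                              *)
Record presentation (k : fieldType) := Presentation {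
  gens : Type;
  prel : term k gens -> term k gens -> Prop;
  paug : gens -> k;
  paugP : @respects k gens prel k^o paug
}.

Lemma respects_cc (k : fieldType) (I : Type)
    (rel : term k I -> term k I -> Prop) (B : algType k) (f : I -> B) :
  respects rel f -> respects (congr_closure rel) f.
Proof.
move=> fP s t; elim=> {s t} //=.
- by move=> s t u _ -> _ ->.
- by move=> s s' t t' _ -> _ ->.
- by move=> s s' t t' _ -> _ ->.
- by move=> *; rewrite addrA.
- by move=> *; rewrite addrC.
- by move=> *; rewrite scale0r add0r.
- by move=> *; rewrite scaleN1r mulN1r scale0r addNr.
- by move=> *; rewrite mulrA.
- by move=> *; rewrite scale1r mul1r.
- by move=> *; rewrite scale1r mulr1.
- by move=> *; rewrite mulrDl.
- by move=> *; rewrite mulrDr.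
- by move=> *; rewrite scalerDl.
- by move=> a b; rewrite -scalerAl mul1r scalerA.
- by move=> a s; rewrite -scalerAl -scalerAr mul1r mulr1.
Qed.

Section PresentedAlgebra.
Variables (k : fieldType) (P : presentation k).
Local Notation tm := (term k (gens P)).
Local Notation cc := (congr_closure (@prel k P)).

Definition ccb (s t : tm) : bool := `[< cc s t >].

Lemma ccb_refl : reflexive ccb.
Proof. by move=> s; apply/asboolP; exact: cc_refl. Qed.
Lemma ccb_sym : symmetric ccb.
Proof. by move=> s t; apply/asboolP/asboolP; exact: cc_sym. Qed.
Lemma ccb_trans : transitive ccb.
Proof. by move=> t s u /asboolP st /asboolP tu; apply/asboolP/(cc_trans st). Qed.

Canonical ccb_equiv := EquivRel ccb ccb_refl ccb_sym ccb_trans.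

Definition presented : Type := {eq_quot ccb}%qT.
HB.instance Definition _ : EqQuotient _ ccb presented := EqQuotient.on presented.
HB.instance Definition _ := Choice.on presented.

Definition tpi (t : tm) : presented := (\pi_presented t)%qT.

Lemma tpi_eq s t : tpi s = tpi t <-> cc s t.
Proof.
split=> [/eqP|st]; last by apply/eqP; rewrite eqmodE; apply/asboolP.
by rewrite eqmodE => /asboolP.
Qed.

Lemma tpiK h : tpi (repr h) = h. Proof. exact: reprK. Qed.

Lemma cc_repr t : cc (repr (tpi t)) t.
Proof. by apply/tpi_eq; rewrite tpiK. Qed.

Definition padd (x y : presented) := tpi (repr x + repr y).
Definition pmul (x y : presented) := tpi (repr x * repr y).
Definition popp (x : presented) := tpi (- repr x).
Definition pscale (a : k) (x : presented) := tpi (Scal a * repr x).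

Lemma paddE s t : padd (tpi s) (tpi t) = tpi (s + t).
Proof. by apply/tpi_eq/cc_add; exact: cc_repr. Qed.
Lemma pmulE s t : pmul (tpi s) (tpi t) = tpi (s * t).
Proof. by apply/tpi_eq/cc_mul; exact: cc_repr. Qed.
Lemma poppE s : popp (tpi s) = tpi (- s).
Proof. by apply/tpi_eq/cc_mul; [exact: cc_refl | exact: cc_repr]. Qed.
Lemma pscaleE a s : pscale a (tpi s) = tpi (Scal a * s).
Proof. by apply/tpi_eq/cc_mul; [exact: cc_refl | exact: cc_repr]. Qed.

Lemma tpi_ind (Q : presented -> Prop) : (forall t, Q (tpi t)) -> forall h, Q h.
Proof. by move=> Qt h; rewrite -(tpiK h). Qed.

Fact paddA : associative padd.
Proof.
elim/tpi_ind=> s; elim/tpi_ind=> t; elim/tpi_ind=> u.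
by rewrite !paddE; apply/tpi_eq; exact: cc_addA.
Qed.
Fact paddC : commutative padd.
Proof.
elim/tpi_ind=> s; elim/tpi_ind=> t.
by rewrite !paddE; apply/tpi_eq; exact: cc_addC.
Qed.
Fact padd0 : left_id (tpi 0) padd.
Proof. by elim/tpi_ind=> s; rewrite paddE; apply/tpi_eq; exact: cc_add0. Qed.
Fact paddN : left_inverse (tpi 0) popp padd.
Proof.
by elim/tpi_ind=> s; rewrite poppE paddE; apply/tpi_eq; exact: cc_addN.
Qed.
HB.instance Definition _ := GRing.isZmodule.Build presented
  paddA paddC padd0 paddN.

Lemma tpiD s t : tpi (s + t) = tpi s + tpi t. Proof. by rewrite -paddE. Qed.

Fact pmulA : associative pmul.
Proof.
elim/tpi_ind=> s; elim/tpi_ind=> t; elim/tpi_ind=> u.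
by rewrite !pmulE; apply/tpi_eq; exact: cc_mulA.
Qed.
Fact pmul1l : left_id (tpi 1) pmul.
Proof. by elim/tpi_ind=> s; rewrite pmulE; apply/tpi_eq; exact: cc_mul1l. Qed.
Fact pmul1r : right_id (tpi 1) pmul.
Proof. by elim/tpi_ind=> s; rewrite pmulE; apply/tpi_eq; exact: cc_mul1r. Qed.
Fact pmulDl : left_distributive pmul +%R.
Proof.
elim/tpi_ind=> s; elim/tpi_ind=> t; elim/tpi_ind=> u.
by rewrite -tpiD !pmulE -tpiD; apply/tpi_eq; exact: cc_mulDl.
Qed.
Fact pmulDr : right_distributive pmul +%R.
Proof.
elim/tpi_ind=> s; elim/tpi_ind=> t; elim/tpi_ind=> u.
by rewrite -tpiD !pmulE -tpiD; apply/tpi_eq; exact: cc_mulDr.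
Qed.
Fact pone_neq0 : tpi 1 != 0.
Proof.
apply/eqP => /tpi_eq /(respects_cc (@paugP _ P)) /= /eqP.
by rewrite scale1r scale0r oner_eq0.
Qed.
HB.instance Definition _ := GRing.Zmodule_isNzRing.Build presented
  pmulA pmul1l pmul1r pmulDl pmulDr pone_neq0.

Lemma tpiM s t : tpi (s * t) = tpi s * tpi t. Proof. by rewrite -pmulE. Qed.

Lemma pscaleM a x : pscale a x = tpi (Scal a) * x.
Proof. by elim/tpi_ind: x => s; rewrite pscaleE tpiM. Qed.

Fact pscalerA a b x : pscale a (pscale b x) = pscale (a * b) x.
Proof.
by rewrite !pscaleM mulrA -tpiM; congr (_ * x); apply/tpi_eq/cc_sym/cc_scalM.
Qed.
Fact pscale1r : left_id 1 pscale.
Proof. by move=> x; rewrite pscaleM [LHS]mul1r. Qed.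
Fact pscalerDr : right_distributive pscale +%R.
Proof. by move=> a x y; rewrite !pscaleM mulrDr. Qed.
Fact pscalerDl x : {morph pscale^~ x : a b / a + b}.
Proof.
move=> a b; rewrite !pscaleM -mulrDl -tpiD.
by congr (_ * x); apply/tpi_eq/cc_scalD.
Qed.
HB.instance Definition _ := GRing.Zmodule_isLmodule.Build k presented
  pscalerA pscale1r pscalerDr pscalerDl.

Lemma tpi_scale a s : tpi (Scal a * s) = a *: tpi s.
Proof. by rewrite -pscaleE. Qed.

Fact pscalerAl (a : k) (x y : presented) : a *: (x * y) = (a *: x) * y.
Proof. by rewrite /GRing.scale /= !pscaleM mulrA. Qed.
HB.instance Definition _ := GRing.Lmodule_isLalgebra.Build k presented
  pscalerAl.
Fact pscalerAr (a : k) (x y : presented) : a *: (x * y) = x * (a *: y).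
Proof.
rewrite /GRing.scale /= !pscaleM !mulrA; congr (_ * y).
by elim/tpi_ind: x => s; rewrite -!tpiM; apply/tpi_eq/cc_scalC.
Qed.
HB.instance Definition _ := GRing.Lalgebra_isAlgebra.Build k presented
  pscalerAr.

Lemma tpi1 : tpi 1 = 1. Proof. by []. Qed.
Lemma tpiS a : tpi (Scal a) = a%:A.
Proof. by rewrite -tpi1 -tpi_scale; apply/tpi_eq/cc_sym/cc_mul1r. Qed.
Lemma tpiN s : tpi (- s) = - tpi s.
Proof. by rewrite tpi_scale scaleN1r. Qed.

Definition pgen (i : gens P) : presented := tpi (Gen i).

Lemma teval_pgen t : teval pgen t = tpi t.
Proof.
by elim: t => //= [a|s -> t ->|s -> t ->]; rewrite ?tpiS ?tpiD ?tpiM.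
Qed.

Lemma pgen_rel : respects (@prel k P) pgen.
Proof. by move=> s t st; rewrite !teval_pgen; apply/tpi_eq/cc_rel. Qed.

Section Lift.
Variables (B : algType k) (f : gens P -> B) (fP : respects (@prel k P) f).

Definition plift (h : presented) : B := teval f (repr h).

Lemma pliftE t : plift (tpi t) = teval f t.
Proof. exact/(respects_cc fP)/cc_repr. Qed.

Lemma plift_pgen i : plift (pgen i) = f i.
Proof. exact: pliftE. Qed.

Lemma plift_linear : linear plift.
Proof.
move=> a; elim/tpi_ind=> s; elim/tpi_ind=> t.
by rewrite -tpi_scale -tpiD !pliftE /= -scalerAl mul1r.
Qed.

Lemma plift1 : plift 1 = 1.
Proof. by rewrite -tpi1 pliftE /= scale1r. Qed.

Lemma pliftM : {morph plift : x y / x * y}.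
Proof.
by elim/tpi_ind=> s; elim/tpi_ind=> t; rewrite -tpiM !pliftE.
Qed.

End Lift.

End PresentedAlgebra.

Section LinearFacts.
Variables (k : fieldType) (U W : lmodType k).

Section Lin.
Variables (f : U -> W) (fL : linear f).
Lemma linP (a : k) x y : f (a *: x + y) = a *: f x + f y. Proof. exact: fL. Qed.
Lemma linD x y : f (x + y) = f x + f y.
Proof. by rewrite -[x]scale1r fL !scale1r. Qed.
Lemma lin0 : f 0 = 0.
Proof. by apply: (addIr (f 0)); rewrite -linD !add0r. Qed.
Lemma linZ (a : k) x : f (a *: x) = a *: f x.
Proof. by rewrite -[a *: x]addr0 fL lin0 !addr0. Qed.
Lemma linN x : f (- x) = - f x.
Proof. by rewrite -scaleN1r linZ scaleN1r. Qed.
Lemma linB x y : f (x - y) = f x - f y.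
Proof. by rewrite linD linN. Qed.
Lemma lin_sum I (r : seq I) (F : I -> U) :
  f (\sum_(i <- r) F i) = \sum_(i <- r) f (F i).
Proof. by apply: big_morph => [x y|]; [exact: linD | exact: lin0]. Qed.
End Lin.

Lemma linear_sumf I (r : seq I) (F : I -> U -> W) :
  (forall i, linear (F i)) -> linear (fun u => \sum_(i <- r) F i u).
Proof.
move=> FL a x y; rewrite scaler_sumr -big_split /=.
by apply: eq_bigr => i _; exact: FL.
Qed.

End LinearFacts.

Section BilinearFacts.
Variables (k : fieldType) (U V W : lmodType k).

Lemma bilinear_sumf I (r : seq I) (F : I -> U -> V -> W) :
  (forall i, bilinear_map (F i)) ->
  bilinear_map (fun u v => \sum_(i <- r) F i u v).
Proof.
by move=> FB; split=> u; apply: linear_sumf => i; [exact: (FB i).1 | exact: (FB i).2].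
Qed.

Lemma bilin_l (f : U -> V -> W) : bilinear_map f -> forall v, linear (fun u => f u v).
Proof. by case. Qed.
Lemma bilin_r (f : U -> V -> W) : bilinear_map f -> forall u, linear (f u).
Proof. by case. Qed.

End BilinearFacts.

Lemma bilinear_mulr (k : fieldType) (A B : algType k) (W : lmodType k)
    (f : A -> B -> W) (c : A) (d : B) :
  bilinear_map f -> bilinear_map (fun a b => f (a * c) (b * d)).
Proof.
by move=> [fl fr]; split=> u a x y /=; rewrite mulrDl -scalerAl; [apply: fl|apply: fr].
Qed.

Lemma bilinear_mull (k : fieldType) (A B : algType k) (W : lmodType k)
    (f : A -> B -> W) (c : A) (d : B) :
  bilinear_map f -> bilinear_map (fun a b => f (c * a) (d * b)).
Proof.
by move=> [fl fr]; split=> u a x y /=; rewrite mulrDr -scalerAr; [apply: fl|apply: fr].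
Qed.

Section TensorFacts.
Variables (k : fieldType).

Lemma teq_refl (U V : lmodType k) (s : tensor U V) : teq s s.
Proof. by []. Qed.
Lemma teq_sym (U V : lmodType k) (s t : tensor U V) : teq s t -> teq t s.
Proof. by move=> st W f fB; rewrite st. Qed.
Lemma teq_trans (U V : lmodType k) (s t u : tensor U V) :
  teq s t -> teq t u -> teq s u.
Proof. by move=> st tu W f fB; rewrite st // tu. Qed.

Lemma tapp_cons (U V W : lmodType k) (f : U -> V -> W) p (s : tensor U V) :
  tapp f (p :: s) = f p.1 p.2 + tapp f s.
Proof. by rewrite /tapp big_cons. Qed.
Lemma tapp_nil (U V W : lmodType k) (f : U -> V -> W) : tapp f [::] = 0.
Proof. by rewrite /tapp big_nil. Qed.
Lemma tapp_cat (U V W : lmodType k) (f : U -> V -> W) (s t : tensor U V) :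
  tapp f (s ++ t) = tapp f s + tapp f t.
Proof. by rewrite /tapp big_cat. Qed.
Lemma tapp_scale (U V W : lmodType k) (f : U -> V -> W) a (s : tensor U V) :
  bilinear_map f -> tapp f (tscale a s) = a *: tapp f s.
Proof.
move=> fB; rewrite /tapp big_map scaler_sumr; apply: eq_bigr => p _ /=.
exact: (linZ (bilin_l fB _)).
Qed.
Lemma tapp_mul (A B : algType k) (W : lmodType k) (f : A -> B -> W)
    (s t : tensor A B) :
  tapp f (tmul s t) =
  \sum_(p <- s) \sum_(q <- t) f (p.1 * q.1) (p.2 * q.2).
Proof. by rewrite /tapp big_allpairs_dep. Qed.

Lemma teq_cat (U V : lmodType k) (s s' t t' : tensor U V) :
  teq s s' -> teq t t' -> teq (s ++ t) (s' ++ t').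
Proof. by move=> ss tt W f fB; rewrite !tapp_cat ss // tt. Qed.

Lemma teq_mul (A B : algType k) (s s' t t' : tensor A B) :
  teq s s' -> teq t t' -> teq (tmul s t) (tmul s' t').
Proof.
move=> ss tt W f fB; rewrite !tapp_mul.
rewrite [LHS](ss _ (fun a b => \sum_(q <- t) f (a * q.1) (b * q.2))).
  apply: eq_bigr => p _; apply: (tt _ (fun a b => f (p.1 * a) (p.2 * b))).
  exact: bilinear_mull.
by apply: bilinear_sumf => q; exact: bilinear_mulr.
Qed.

End TensorFacts.

(* dgen and sgen are the values of the comultiplication and of the antipode  *)
(* on the generators; they extend multiplicatively and antimultiplicatively. *)
Section PresentedHopf.
Variables (k : fieldType) (P : presentation k).
Local Notation H := (presented P).
Variables (dgen : gens P -> tensor H H) (sgen : gens P -> H).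

Fixpoint tcomul (t : term k (gens P)) : tensor H H :=
  match t with
  | Gen i => dgen i
  | Scal c => [:: (c%:A, 1)]
  | Add s t => tcomul s ++ tcomul t
  | Mul s t => tmul (tcomul s) (tcomul t)
  end.

Fixpoint tantipode (t : term k (gens P)) : H :=
  match t with
  | Gen i => sgen i
  | Scal c => c%:A
  | Add s t => tantipode s + tantipode t
  | Mul s t => tantipode t * tantipode s
  end.

(* The list depends on the chosen representative of h, the tensor it denotes *)
(* does not (pcomulE).                                                       *)
Definition pcomul (h : H) : tensor H H := tcomul (repr h).
Definition pcounit : H -> k := plift (@paug k P : _ -> k^o).
Definition pantipode (h : H) : H := tantipode (repr h).

Hypothesis tcomul_rel : forall s t, prel s t -> teq (tcomul s) (tcomul t).
Hypothesis tantipode_rel : forall s t, prel s t -> tantipode s = tantipode t.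

Lemma tcomul_cc s t : congr_closure (@prel k P) s t -> teq (tcomul s) (tcomul t).
Proof.
elim=> {s t} /=.
- exact: tcomul_rel.
- by move=> s; exact: teq_refl.
- by move=> s t _; exact: teq_sym.
- by move=> s t u _ st _; exact: teq_trans.
- by move=> s s' t t' _ ss _; exact: teq_cat.
- by move=> s s' t t' _ ss _; exact: teq_mul.
- by move=> s t u W f fB; rewrite !tapp_cat addrA.
- by move=> s t W f fB; rewrite !tapp_cat addrC.
- move=> s W f fB; rewrite tapp_cons /= scale0r.
  by rewrite (lin0 (bilin_l fB _)) add0r.
- move=> s W f fB; rewrite tapp_cat tapp_mul big_seq1 /= tapp_cons tapp_nil /=.
  rewrite scale0r (lin0 (bilin_l fB _)) addr0 -[X in _ + X]scale1r.
  rewrite -[X in X + _]/(tapp (fun a b => f ((-1)%:A * a) (1 * b)) (tcomul s)).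
  rewrite (_ : tapp _ _ = (-1) *: tapp f (tcomul s)) -?scalerDl ?addNr ?scale0r //.
  rewrite /tapp scaler_sumr; apply: eq_bigr => p _ /=.
  by rewrite mul1r -scalerAl mul1r (linZ (bilin_l fB _)).
- move=> s t u W f fB; rewrite !tapp_mul big_allpairs_dep /=.
  apply: eq_bigr => p _; rewrite big_allpairs_dep /=.
  by apply: eq_bigr => q _; apply: eq_bigr => r _; rewrite !mulrA.
- move=> s W f fB; rewrite tapp_mul big_seq1 /=.
  by apply: eq_bigr => p _; rewrite scale1r !mul1r.
- move=> s W f fB; rewrite tapp_mul; apply: eq_bigr => p _.
  by rewrite big_seq1 /= scale1r !mulr1.
- by move=> s t u W f fB; rewrite tapp_cat !tapp_mul big_cat.
- move=> s t u W f fB; rewrite tapp_cat !tapp_mul -big_split /=.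
  by apply: eq_bigr => p _; rewrite big_cat.
- move=> a b W f fB; rewrite !tapp_cons tapp_nil /= !addr0 scalerDl.
  exact: (linD (bilin_l fB _)).
- move=> a b W f fB; rewrite !tapp_cons tapp_nil /= !addr0.
  by rewrite -scalerAl !mul1r scalerA.
- move=> a s W f fB; rewrite !tapp_mul big_seq1 /=; apply: eq_bigr => p _.
  by rewrite big_seq1 /= -scalerAl -scalerAr !mul1r !mulr1.
Qed.

Lemma tantipode_cc s t :
  congr_closure (@prel k P) s t -> tantipode s = tantipode t.
Proof.
elim=> {s t} //=.
- by move=> s t u _ -> _ ->.
- by move=> s s' t t' _ -> _ ->.
- by move=> s s' t t' _ -> _ ->.
- by move=> *; rewrite addrA.
- by move=> *; rewrite addrC.
- by move=> *; rewrite scale0r add0r.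
- by move=> *; rewrite scaleN1r mulrN1 scale0r addNr.
- by move=> *; rewrite mulrA.
- by move=> *; rewrite scale1r mulr1.
- by move=> *; rewrite scale1r mul1r.
- by move=> *; rewrite mulrDr.
- by move=> *; rewrite mulrDl.
- by move=> *; rewrite scalerDl.
- by move=> a b; rewrite -scalerAr mulr1 scalerA mulrC.
- by move=> a s; rewrite -scalerAl -scalerAr mul1r mulr1.
Qed.

Lemma pcomulE t : teq (pcomul (tpi t)) (tcomul t).
Proof. exact/tcomul_cc/cc_repr. Qed.
Lemma pantipodeE t : pantipode (tpi t) = tantipode t.
Proof. exact/tantipode_cc/cc_repr. Qed.
Lemma pcounitE t : pcounit (tpi t) = teval (@paug k P : _ -> k^o) t.
Proof. exact: (pliftE (@paugP k P)). Qed.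

Lemma presented_ind (Q : H -> Prop) :
  (forall i, Q (pgen i)) -> (forall a : k, Q a%:A) ->
  (forall x y, Q x -> Q y -> Q (x + y)) ->
  (forall x y, Q x -> Q y -> Q (x * y)) -> forall h, Q h.
Proof.
move=> Qg Qs QD QM; elim/tpi_ind; elim=> [//|a|s Qs' t Qt|s Qs' t Qt].
- by rewrite tpiS.
- by rewrite tpiD; exact: QD.
- by rewrite tpiM; exact: QM.
Qed.

Lemma pcomul_lin (a : k) (x y : H) :
  teq (pcomul (a *: x + y)) (tscale a (pcomul x) ++ pcomul y).
Proof.
elim/tpi_ind: x => s; elim/tpi_ind: y => t; rewrite -tpi_scale -tpiD => W f fB.
rewrite pcomulE // tapp_cat tapp_scale // !pcomulE //= tapp_cat; congr (_ + _).
rewrite tapp_mul big_seq1 /tapp scaler_sumr; apply: eq_bigr => p _ /=.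
by rewrite mul1r -scalerAl mul1r (linZ (bilin_l fB _)).
Qed.

Lemma pcomul_scal (a : k) : teq (pcomul a%:A) [:: (a%:A, 1)].
Proof. by move=> W f fB; rewrite -[in LHS]tpiS pcomulE. Qed.

Lemma pcomul1 : teq (pcomul 1) [:: (1, 1)].
Proof. by have := pcomul_scal 1; rewrite scale1r. Qed.

Lemma pcomulD (x y : H) : teq (pcomul (x + y)) (pcomul x ++ pcomul y).
Proof.
elim/tpi_ind: x => s; elim/tpi_ind: y => t; rewrite -tpiD => W f fB.
by rewrite pcomulE // tapp_cat !pcomulE //= tapp_cat.
Qed.

Lemma pcomulM (x y : H) : teq (pcomul (x * y)) (tmul (pcomul x) (pcomul y)).
Proof.
elim/tpi_ind: x => s; elim/tpi_ind: y => t; rewrite -tpiM.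
apply: teq_trans (pcomulE _) _; apply: teq_sym.
by apply: teq_mul; exact: pcomulE.
Qed.

Lemma pcomul_gen i : teq (pcomul (pgen i)) (dgen i).
Proof. exact: pcomulE. Qed.

Lemma tapp_pcomul_linear (W : lmodType k) (f : H -> H -> W) :
  bilinear_map f -> linear (fun h => tapp f (pcomul h)).
Proof. by move=> fB a x y; rewrite pcomul_lin // tapp_cat tapp_scale. Qed.

Lemma tapp_pcomulM (W : lmodType k) (f : H -> H -> W) x y : bilinear_map f ->
  tapp f (pcomul (x * y)) =
  \sum_(p <- pcomul x) \sum_(q <- pcomul y) f (p.1 * q.1) (p.2 * q.2).
Proof. by move=> fB; rewrite pcomulM // tapp_mul. Qed.

Lemma pcounit_lin (a : k) (x y : H) :
  pcounit (a *: x + y) = a * pcounit x + pcounit y.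
Proof. exact: (plift_linear (@paugP k P)). Qed.
Lemma pcounit1 : pcounit 1 = 1.
Proof. exact: (plift1 (@paugP k P)). Qed.
Lemma pcounitM (x y : H) : pcounit (x * y) = pcounit x * pcounit y.
Proof. exact: (pliftM (@paugP k P)). Qed.
Lemma pcounit_linear : linear (pcounit : H -> k^o).
Proof. exact: (plift_linear (@paugP k P)). Qed.
Lemma pcounit_scal (a : k) : pcounit a%:A = a.
Proof. by rewrite (linZ pcounit_linear) pcounit1; exact: mulr1. Qed.

Lemma pantipode_lin (a : k) (x y : H) :
  pantipode (a *: x + y) = a *: pantipode x + pantipode y.
Proof.
elim/tpi_ind: x => s; elim/tpi_ind: y => t.
by rewrite -tpi_scale -tpiD !pantipodeE /= -scalerAr mulr1.
Qed.
Lemma pantipode_linear : linear pantipode. Proof. exact: pantipode_lin. Qed.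
Lemma pantipodeM (x y : H) : pantipode (x * y) = pantipode y * pantipode x.
Proof.
by elim/tpi_ind: x => s; elim/tpi_ind: y => t; rewrite -tpiM !pantipodeE.
Qed.
Lemma pantipode1 : pantipode 1 = 1.
Proof. by rewrite -tpi1 pantipodeE /= scale1r. Qed.

Lemma bil_counitl : bilinear_map (fun a b : H => pcounit a *: b).
Proof.
split=> u a x y /=.
  by rewrite pcounit_linear scalerDl scalerA.
by rewrite scalerDr !scalerA mulrC.
Qed.
Lemma bil_counitr : bilinear_map (fun a b : H => pcounit b *: a).
Proof. by case: bil_counitl => l r; split=> u; [exact: r | exact: l]. Qed.
Lemma bil_antipodel : bilinear_map (fun a b : H => pantipode a * b).
Proof.
split=> u a x y /=.
  by rewrite pantipode_lin mulrDl scalerAl.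
by rewrite mulrDr scalerAr.
Qed.
Lemma bil_antipoder : bilinear_map (fun a b : H => a * pantipode b).
Proof.
split=> u a x y /=.
  by rewrite mulrDl scalerAl.
by rewrite pantipode_lin mulrDr scalerAr.
Qed.

Hypothesis dgen_coassoc : forall i (W : lmodType k) (f : H -> H -> H -> W),
  trilinear_map f ->
  \sum_(p <- dgen i) tapp (fun a b => f a b p.2) (pcomul p.1) =
  \sum_(p <- dgen i) tapp (f p.1) (pcomul p.2).
Hypothesis dgen_counitl :
  forall i, \sum_(p <- dgen i) pcounit p.1 *: p.2 = pgen i.
Hypothesis dgen_counitr :
  forall i, \sum_(p <- dgen i) pcounit p.2 *: p.1 = pgen i.
Hypothesis dgen_antipodel :
  forall i, \sum_(p <- dgen i) pantipode p.1 * p.2 = (paug i)%:A.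
Hypothesis dgen_antipoder :
  forall i, \sum_(p <- dgen i) p.1 * pantipode p.2 = (paug i)%:A.

Lemma tri12 (W : lmodType k) (f : H -> H -> H -> W) : trilinear_map f ->
  forall c, bilinear_map (fun a b => f a b c).
Proof.
move=> [f23 f1] c; split=> u; first exact: f1.
exact: (bilin_l (f23 u)).
Qed.

Lemma bil_coassocl (W : lmodType k) (f : H -> H -> H -> W) : trilinear_map f ->
  bilinear_map (fun a c => tapp (fun u v => f u v c) (pcomul a)).
Proof.
move=> fT; split=> u; first exact/tapp_pcomul_linear/(tri12 fT).
by rewrite /tapp; apply: linear_sumf => p; case: fT => f23 _; exact: (bilin_r (f23 _)).
Qed.

Lemma bil_coassocr (W : lmodType k) (f : H -> H -> H -> W) : trilinear_map f ->
  bilinear_map (fun a c => tapp (f a) (pcomul c)).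
Proof.
move=> fT; split=> u; last by apply: tapp_pcomul_linear; case: fT.
by rewrite /tapp; apply: linear_sumf => p; case: fT => _; exact.
Qed.

Lemma pcomulA (h : H) (W : lmodType k) (f : H -> H -> H -> W) :
  trilinear_map f ->
  \sum_(p <- pcomul h) \sum_(q <- pcomul p.1) f q.1 q.2 p.2 =
  \sum_(p <- pcomul h) \sum_(q <- pcomul p.2) f p.1 q.1 q.2.
Proof.
move=> fT.
pose L f h := tapp (fun a c => tapp (fun u v => f u v c : W) (pcomul a)) (pcomul h).
pose R f h := tapp (fun a c => tapp (f a : _ -> _ -> W) (pcomul c)) (pcomul h).
rewrite -[LHS]/(L f h) -[RHS]/(R f h).
elim/presented_ind: h f fT => [i|a|x y IHx IHy|x y IHx IHy] f fT; rewrite /L /R.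
- have bl := bil_coassocl fT; have br := bil_coassocr fT.
  by rewrite !(pcomul_gen i) //; exact: dgen_coassoc.
- have bl := bil_coassocl fT; have br := bil_coassocr fT.
  rewrite !(pcomul_scal a) // !tapp_cons !tapp_nil !addr0 /=.
  have bc := tri12 fT 1; case: (fT) => f23 _.
  rewrite (pcomul_scal a) // (pcomul1 (f23 _)).
  by rewrite !tapp_cons !tapp_nil.
- have bl := bil_coassocl fT; have br := bil_coassocr fT.
  by rewrite !pcomulD // !tapp_cat; congr (_ + _); [exact: IHx | exact: IHy].
- have bl := bil_coassocl fT; have br := bil_coassocr fT.
  rewrite !tapp_pcomulM //.
  pose g a b c := \sum_(q <- pcomul y)
    tapp (fun u v => f (a * u) (b * v) (c * q.2)) (pcomul q.1).
  have gT : trilinear_map g.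
    case: (fT) => f23 f1; rewrite /g; split=> [a|b c].
      apply: bilinear_sumf => q; rewrite /tapp; apply: bilinear_sumf => q'.
      exact: bilinear_mulr.
    apply: linear_sumf => q; rewrite /tapp; apply: linear_sumf => q' d u v.
    by rewrite mulrDl -scalerAl f1.
  have gE a b c : g a b c = \sum_(q <- pcomul y)
      tapp (fun u v => f (a * q.1) (b * u) (c * v)) (pcomul q.2).
    pose f' u v w := f (a * u) (b * v) (c * w).
    have f'T : trilinear_map f'.
      case: (fT) => f23 f1; split=> [u|v w]; first exact: bilinear_mull.
      by move=> d u u'; rewrite /f' mulrDr -scalerAr f1.
    exact: (IHy f' f'T).
  transitivity (L g x).
    apply: eq_bigr => p _; rewrite /tapp exchange_big /g /=.
    apply: eq_bigr => q _; rewrite -[LHS]/(tapp (fun u v => f u v (p.2 * q.2)) _).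
    rewrite tapp_pcomulM //; exact: tri12.
  rewrite IHx //; apply: eq_bigr => p _; rewrite /tapp.
  under eq_bigr => p' _ do rewrite gE.
  rewrite exchange_big /=; apply: eq_bigr => q _.
  rewrite -[RHS]/(tapp (f (p.1 * q.1)) _) tapp_pcomulM //.
  by case: fT.
Qed.

Lemma pcounitl (h : H) : \sum_(p <- pcomul h) pcounit p.1 *: p.2 = h.
Proof.
rewrite -[LHS]/(tapp (fun a b => pcounit a *: b) (pcomul h)).
have B := bil_counitl.
elim/presented_ind: h => [i|a|x y IHx IHy|x y IHx IHy].
- by rewrite pcomul_gen //; exact: dgen_counitl.
- by rewrite pcomul_scal // tapp_cons tapp_nil addr0 /= pcounit_scal.
- by rewrite pcomulD // tapp_cat IHx IHy.
- rewrite tapp_pcomulM // -{2}IHx -{2}IHy /tapp mulr_suml.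
  apply: eq_bigr => p _; rewrite mulr_sumr; apply: eq_bigr => q _.
  by rewrite pcounitM -scalerAl -scalerAr scalerA.
Qed.

Lemma pcounitr (h : H) : \sum_(p <- pcomul h) pcounit p.2 *: p.1 = h.
Proof.
rewrite -[LHS]/(tapp (fun a b => pcounit b *: a) (pcomul h)).
have B := bil_counitr.
elim/presented_ind: h => [i|a|x y IHx IHy|x y IHx IHy].
- by rewrite pcomul_gen //; exact: dgen_counitr.
- by rewrite pcomul_scal // tapp_cons tapp_nil addr0 /= pcounit1 scale1r.
- by rewrite pcomulD // tapp_cat IHx IHy.
- rewrite tapp_pcomulM // -{2}IHx -{2}IHy /tapp mulr_suml.
  apply: eq_bigr => p _; rewrite mulr_sumr; apply: eq_bigr => q _.
  by rewrite pcounitM -scalerAl -scalerAr scalerA.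
Qed.

Lemma pcounit_gen i : pcounit (pgen i) = paug i.
Proof. exact: pcounitE. Qed.

Lemma pcounitD x y : pcounit (x + y) = pcounit x + pcounit y.
Proof. exact: (linD pcounit_linear). Qed.

Lemma pantipodel (h : H) :
  \sum_(p <- pcomul h) pantipode p.1 * p.2 = (pcounit h)%:A.
Proof.
rewrite -[LHS]/(tapp (fun a b => pantipode a * b) (pcomul h)).
have B := bil_antipodel.
elim/presented_ind: h => [i|a|x y IHx IHy|x y IHx IHy].
- by rewrite pcomul_gen // pcounit_gen; exact: dgen_antipodel.
- rewrite pcomul_scal // tapp_cons tapp_nil addr0 /= pcounit_scal mulr1.
  by rewrite (linZ pantipode_linear) pantipode1.
- by rewrite pcomulD // tapp_cat IHx IHy pcounitD scalerDl.
- rewrite tapp_pcomulM // exchange_big /=.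
  have E q : \sum_(p <- pcomul x) pantipode (p.1 * q.1) * (p.2 * q.2)
      = pcounit x *: (pantipode q.1 * q.2).
    transitivity (pantipode q.1 * (pcounit x)%:A * q.2).
      rewrite -IHx /tapp mulr_sumr mulr_suml; apply: eq_bigr => p _.
      by rewrite pantipodeM !mulrA.
    by rewrite -scalerAr mulr1 scalerAl.
  under eq_bigr => q _ do rewrite E.
  rewrite -scaler_sumr pcounitM -scalerA; congr (_ *: _); exact: IHy.
Qed.

Lemma pantipoder (h : H) :
  \sum_(p <- pcomul h) p.1 * pantipode p.2 = (pcounit h)%:A.
Proof.
rewrite -[LHS]/(tapp (fun a b => a * pantipode b) (pcomul h)).
have B := bil_antipoder.
elim/presented_ind: h => [i|a|x y IHx IHy|x y IHx IHy].
- by rewrite pcomul_gen // pcounit_gen; exact: dgen_antipoder.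
- by rewrite pcomul_scal // tapp_cons tapp_nil addr0 /= pcounit_scal pantipode1 mulr1.
- by rewrite pcomulD // tapp_cat IHx IHy pcounitD scalerDl.
- rewrite tapp_pcomulM //.
  have E p : \sum_(q <- pcomul y) (p.1 * q.1) * pantipode (p.2 * q.2)
      = pcounit y *: (p.1 * pantipode p.2).
    transitivity (p.1 * (pcounit y)%:A * pantipode p.2).
      rewrite -IHy /tapp mulr_sumr mulr_suml; apply: eq_bigr => q _.
      by rewrite pantipodeM !mulrA.
    by rewrite -scalerAr mulr1 scalerAl.
  under eq_bigr => p _ do rewrite E.
  rewrite -scaler_sumr pcounitM mulrC -scalerA; congr (_ *: _); exact: IHx.
Qed.

Definition presented_hopf : hopfAlg k :=
  HopfAlg pcomul_lin pcomul1 pcomulM pcounit_lin pcounit1 pcounitM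
    pantipode_lin pcomulA pcounitl pcounitr pantipodel pantipoder.

End PresentedHopf.

Inductive sweedler_gen := Sg | Sx.

Section Sweedler.
Variable k : fieldType.
Local Notation g := (@Gen k _ Sg).
Local Notation x := (@Gen k _ Sx).

Inductive sweedler_rel : term k sweedler_gen -> term k sweedler_gen -> Prop :=
  | sw_gg : sweedler_rel (g * g) 1
  | sw_xx : sweedler_rel (x * x) 0
  | sw_gx : sweedler_rel (g * x) (- (x * g)).

Definition sweedler_aug (i : sweedler_gen) : k :=
  match i with Sg => 1 | Sx => 0 end.

Fact sweedler_augP : @respects k _ sweedler_rel k^o sweedler_aug.
Proof.
by move=> s t [] /=;
  rewrite ?mulr1 ?mulr0 ?mul0r ?scale1r ?scale0r ?scaler0 ?mul1r ?mulr0.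
Qed.

Definition sweedler_pres : presentation k := Presentation sweedler_augP.
Definition sweedler_alg : algType k := presented sweedler_pres.

Definition sweedler_g : sweedler_alg := @pgen k sweedler_pres Sg.
Definition sweedler_x : sweedler_alg := @pgen k sweedler_pres Sx.

Definition sweedler_comul (i : sweedler_gen) : tensor sweedler_alg sweedler_alg :=
  match i with
  | Sg => [:: (sweedler_g, sweedler_g)]
  | Sx => [:: (sweedler_g, sweedler_x); (sweedler_x, 1)]
  end.

Definition sweedler_antipode (i : sweedler_gen) : sweedler_alg :=
  match i with
  | Sg => sweedler_g
  | Sx => - (sweedler_g * sweedler_x)
  end.

Lemma sweedler_ggE : sweedler_g * sweedler_g = 1.
Proof. by have := @pgen_rel k sweedler_pres _ _ sw_gg; rewrite /= scale1r. Qed.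
Lemma sweedler_xxE : sweedler_x * sweedler_x = 0.
Proof. by have := @pgen_rel k sweedler_pres _ _ sw_xx; rewrite /= scale0r. Qed.
Lemma sweedler_gxE : sweedler_g * sweedler_x = - (sweedler_x * sweedler_g).
Proof.
by have := @pgen_rel k sweedler_pres _ _ sw_gx; rewrite /= scaleN1r mulN1r.
Qed.

Local Notation tcomulS := (@tcomul k sweedler_pres sweedler_comul).

Fact sweedler_comul_rel s t : sweedler_rel s t -> teq (tcomulS s) (tcomulS t).
Proof.
case=> W f fB; rewrite /tapp /= !big_cons !big_nil /= ?addr0;
  rewrite ?scale1r ?scale0r ?scaleN1r ?mulN1r ?mul1r ?mulr1;
  rewrite ?sweedler_ggE ?sweedler_xxE ?sweedler_gxE //;
  rewrite ?(linN (bilin_l fB _)) ?(linN (bilin_r fB _)) ?(lin0 (bilin_l fB _)).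
- by rewrite (lin0 (bilin_r fB _)) add0r addr0 addNr.
- by rewrite ?opprK.
Qed.

Fact sweedler_antipode_rel s t : sweedler_rel s t ->
  @tantipode k sweedler_pres sweedler_antipode s =
  @tantipode k sweedler_pres sweedler_antipode t.
Proof.
case=> /=; rewrite ?scale1r ?scale0r ?scaleN1r ?mulrN1 ?mulNr ?mulrN ?opprK.
- exact: sweedler_ggE.
- rewrite {1}sweedler_gxE mulNr -mulrA [X in _ * X]mulrA sweedler_ggE mul1r.
  by rewrite sweedler_xxE oppr0.
- rewrite mulrA sweedler_ggE mul1r sweedler_gxE mulNr opprK -mulrA.
  by rewrite sweedler_ggE mulr1.
Qed.

Local Notation pcomulS := (@pcomul k sweedler_pres sweedler_comul).
Local Notation pantipodeS := (@pantipode k sweedler_pres sweedler_antipode).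

Fact sweedler_coassoc i (W : lmodType k)
    (f : sweedler_alg -> sweedler_alg -> sweedler_alg -> W) :
  trilinear_map f ->
  \sum_(p <- sweedler_comul i) tapp (fun a b => f a b p.2) (pcomulS p.1) =
  \sum_(p <- sweedler_comul i) tapp (f p.1) (pcomulS p.2).
Proof.
move=> fT; have f12 c := tri12 fT c; case: (fT) => f23 _.
have E := @pcomul_gen k sweedler_pres _ sweedler_comul_rel; have E1 := @pcomul1 k sweedler_pres _ sweedler_comul_rel.
case: i; rewrite /= !big_cons !big_nil /= ?addr0.
  by rewrite !(E Sg) // !tapp_cons !tapp_nil.
by rewrite (E Sg) // !(E Sx) // E1 // !tapp_cons !tapp_nil /= !addr0 addrA.
Qed.

Fact sweedler_counitl i :
  \sum_(p <- sweedler_comul i) pcounit p.1 *: p.2 = @pgen k sweedler_pres i.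
Proof.
by case: i; rewrite /= !big_cons !big_nil /= !pcounit_gen /= scale1r ?scale0r !addr0.
Qed.

Fact sweedler_counitr i :
  \sum_(p <- sweedler_comul i) pcounit p.2 *: p.1 = @pgen k sweedler_pres i.
Proof.
by case: i; rewrite /= !big_cons !big_nil /= !pcounit_gen /= ?pcounit1 !scale1r
  ?scale0r ?add0r !addr0.
Qed.

Fact sweedler_antipodel i :
  \sum_(p <- sweedler_comul i) pantipodeS p.1 * p.2 = (sweedler_aug i)%:A.
Proof.
have E j : pantipodeS (pgen j) = sweedler_antipode j.
  exact: (@pantipodeE k sweedler_pres _ sweedler_antipode_rel).
case: i; rewrite /= !big_cons !big_nil /= !E /= ?addr0.
  by rewrite sweedler_ggE scale1r.
by rewrite mulr1 subrr scale0r.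
Qed.

Fact sweedler_antipoder i :
  \sum_(p <- sweedler_comul i) p.1 * pantipodeS p.2 = (sweedler_aug i)%:A.
Proof.
have E j : pantipodeS (pgen j) = sweedler_antipode j.
  exact: (@pantipodeE k sweedler_pres _ sweedler_antipode_rel).
case: i; rewrite /= !big_cons !big_nil /= !E ?(@pantipode1 k sweedler_pres _ sweedler_antipode_rel) /= ?addr0.
  by rewrite sweedler_ggE scale1r.
by rewrite mulr1 mulrN mulrA sweedler_ggE mul1r addNr scale0r.
Qed.

Definition sweedler : hopfAlg k :=
  @presented_hopf k sweedler_pres sweedler_comul sweedler_antipode
    sweedler_comul_rel sweedler_antipode_rel sweedler_coassoc
    sweedler_counitl sweedler_counitr sweedler_antipodel sweedler_antipoder.

Lemma sweedler_g_grouplike : grouplike (sweedler_g : sweedler).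
Proof.
split; last exact: (@pcomul_gen k sweedler_pres _ sweedler_comul_rel).
apply/eqP => g0; have /eqP := sweedler_ggE.
by rewrite g0 mul0r eq_sym oner_eq0.
Qed.

Lemma sweedler_x_skew :
  skew_primitive (sweedler_g : sweedler) 1 (sweedler_x : sweedler).
Proof. exact: (@pcomul_gen k sweedler_pres _ sweedler_comul_rel). Qed.

End Sweedler.

Inductive double_gen := Dg | DG | Dx | DX.

Section Double.
Variable k : fieldType.
Local Notation g := (@Gen k _ Dg).
Local Notation G := (@Gen k _ DG).
Local Notation x := (@Gen k _ Dx).
Local Notation X := (@Gen k _ DX).

Inductive double_rel : term k double_gen -> term k double_gen -> Prop :=
  | dbl_gg : double_rel (g * g) 1
  | dbl_GG : double_rel (G * G) 1
  | dbl_xx : double_rel (x * x) 0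
  | dbl_XX : double_rel (X * X) 0
  | dbl_gx : double_rel (g * x) (- (x * g))
  | dbl_GX : double_rel (G * X) (- (X * G))
  | dbl_gG : double_rel (g * G) (G * g)
  | dbl_xG : double_rel (x * G) (- (G * x))
  | dbl_gX : double_rel (g * X) (- (X * g))
  | dbl_xX : double_rel (x * X) (X * x + G - g).

Definition double_aug (i : double_gen) : k :=
  match i with Dg | DG => 1 | Dx | DX => 0 end.

Fact double_augP : @respects k _ double_rel k^o double_aug.
Proof.
by move=> s t [] /=;
  rewrite ?mulr1 ?mulr0 ?mul0r ?scale1r ?scale0r ?scaler0 ?mul1r ?mulr0 //;
  rewrite add0r scaleN1r subrr.
Qed.

Definition double_pres : presentation k := Presentation double_augP.
Definition double_alg : algType k := presented double_pres.

Definition double_g : double_alg := @pgen k double_pres Dg.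
Definition double_G : double_alg := @pgen k double_pres DG.
Definition double_x : double_alg := @pgen k double_pres Dx.
Definition double_X : double_alg := @pgen k double_pres DX.

Definition double_comul (i : double_gen) : tensor double_alg double_alg :=
  match i with
  | Dg => [:: (double_g, double_g)]
  | DG => [:: (double_G, double_G)]
  | Dx => [:: (double_g, double_x); (double_x, 1)]
  | DX => [:: (1, double_X); (double_X, double_G)]
  end.

Definition double_antipode (i : double_gen) : double_alg :=
  match i with
  | Dg => double_g
  | DG => double_G
  | Dx => - (double_g * double_x)
  | DX => - (double_X * double_G)
  end.

Local Notation dg := double_g.
Local Notation dG := double_G.
Local Notation dx := double_x.
Local Notation dX := double_X.

Lemma double_ggE : dg * dg = 1.
Proof. by have := @pgen_rel k double_pres _ _ dbl_gg; rewrite /= scale1r. Qed.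
Lemma double_GGE : dG * dG = 1.
Proof. by have := @pgen_rel k double_pres _ _ dbl_GG; rewrite /= scale1r. Qed.
Lemma double_xxE : dx * dx = 0.
Proof. by have := @pgen_rel k double_pres _ _ dbl_xx; rewrite /= scale0r. Qed.
Lemma double_XXE : dX * dX = 0.
Proof. by have := @pgen_rel k double_pres _ _ dbl_XX; rewrite /= scale0r. Qed.
Lemma double_gxE : dg * dx = - (dx * dg).
Proof.
by have := @pgen_rel k double_pres _ _ dbl_gx; rewrite /= scaleN1r mulN1r.
Qed.
Lemma double_GXE : dG * dX = - (dX * dG).
Proof.
by have := @pgen_rel k double_pres _ _ dbl_GX; rewrite /= scaleN1r mulN1r.
Qed.
Lemma double_gGE : dg * dG = dG * dg.
Proof. exact: (@pgen_rel k double_pres _ _ dbl_gG). Qed.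
Lemma double_xGE : dx * dG = - (dG * dx).
Proof.
by have := @pgen_rel k double_pres _ _ dbl_xG; rewrite /= scaleN1r mulN1r.
Qed.
Lemma double_gXE : dg * dX = - (dX * dg).
Proof.
by have := @pgen_rel k double_pres _ _ dbl_gX; rewrite /= scaleN1r mulN1r.
Qed.
Lemma double_xXE : dx * dX = dX * dx + dG - dg.
Proof.
by have := @pgen_rel k double_pres _ _ dbl_xX; rewrite /= scaleN1r mulN1r.
Qed.

Local Notation tcomulD := (@tcomul k double_pres double_comul).

Fact double_comul_rel s t : double_rel s t -> teq (tcomulD s) (tcomulD t).
Proof.
case=> W f fB; rewrite /tapp /= !big_cons !big_nil /= ?addr0;
  rewrite ?scale1r ?scale0r ?scaleN1r ?mulN1r ?mul1r ?mulr1;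
  have fl := bilin_l fB; have fr := bilin_r fB;
  rewrite ?double_ggE ?double_GGE ?double_xxE ?double_XXE ?double_gxE
    ?double_GXE ?double_xGE ?double_gXE ?double_gGE //;
  rewrite ?(linN (fl _)) ?(linN (fr _)) ?(lin0 (fl _)) ?(lin0 (fr _)) ?opprK;
  rewrite ?add0r ?addr0 ?addNr ?subrr //.
rewrite double_xXE (linB (fl _)) (linB (fr _)) (linD (fl _)) (linD (fr _)).
rewrite -!addrA; congr (_ + _).
by rewrite addrC -!addrA addNr addr0 addrC -!addrA addrCA.
Qed.

Fact double_antipode_rel s t : double_rel s t ->
  @tantipode k double_pres double_antipode s =
  @tantipode k double_pres double_antipode t.
Proof.
have gxg : dg * dx * dg = - dx.
  by rewrite double_gxE mulNr -mulrA double_ggE mulr1.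
have GXG : dG * dX * dG = - dX.
  by rewrite double_GXE mulNr -mulrA double_GGE mulr1.
case=> /=; rewrite ?scale1r ?scale0r ?scaleN1r ?mulrN1 ?mulNr ?mulrN ?opprK.
- exact: double_ggE.
- exact: double_GGE.
- by rewrite mulrA gxg mulNr double_xxE oppr0.
- by rewrite -mulrA [dG * _]mulrA GXG mulrN double_XXE oppr0.
- by rewrite gxg opprK mulrA double_ggE mul1r.
- by rewrite -mulrA double_GGE mulr1 mulrA GXG.
- by rewrite double_gGE.
- by rewrite -mulrA double_xGE mulrN !mulrA double_gGE.
- by rewrite [RHS]mulrA double_gXE mulNr -!mulrA double_gGE.
- have E1 : dX * dG * (dg * dx) = dG * dg * (dX * dx).
    by rewrite mulrA -[dX * _]opprK -double_GXE mulNr -[dG * dX * dg]mulrA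
      -[dX * dg]opprK -double_gXE mulrN opprK; rewrite -!mulrA.
  have E2 : dg * dx * (dX * dG) = dG * dg * (dx * dX).
    rewrite -double_gGE -!mulrA; congr (dg * _).
    by rewrite !mulrA -[dG * dx]opprK -double_xGE mulNr -[dx * dG * dX]mulrA
      double_GXE mulrN opprK mulrA.
  have E3 : dG * dg * dG = dg by rewrite -double_gGE -mulrA double_GGE mulr1.
  have E4 : dG * dg * dg = dG by rewrite -mulrA double_ggE mulr1.
  rewrite E1 E2 double_xXE !mulrDr mulrN E3 E4.
  by rewrite subrK addrK.
Qed.

Local Notation pcomulDbl := (@pcomul k double_pres double_comul).
Local Notation pantipodeD := (@pantipode k double_pres double_antipode).

Fact double_coassoc i (W : lmodType k)
    (f : double_alg -> double_alg -> double_alg -> W) :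
  trilinear_map f ->
  \sum_(p <- double_comul i) tapp (fun a b => f a b p.2) (pcomulDbl p.1) =
  \sum_(p <- double_comul i) tapp (f p.1) (pcomulDbl p.2).
Proof.
move=> fT; have f12 c := tri12 fT c; case: (fT) => f23 _.
have E := @pcomul_gen k double_pres _ double_comul_rel.
have E1 := @pcomul1 k double_pres _ double_comul_rel.
case: i; rewrite /= !big_cons !big_nil /= ?addr0.
- by rewrite !(E Dg) // !tapp_cons !tapp_nil.
- by rewrite !(E DG) // !tapp_cons !tapp_nil.
- by rewrite (E Dg) // !(E Dx) // E1 // !tapp_cons !tapp_nil /= !addr0 addrA.
- by rewrite (E DG) // !(E DX) // E1 // !tapp_cons !tapp_nil /= !addr0 addrA.
Qed.

Fact double_counitl i :
  \sum_(p <- double_comul i) pcounit p.1 *: p.2 = @pgen k double_pres i.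
Proof.
by case: i; rewrite /= !big_cons !big_nil /= !pcounit_gen /= ?pcounit1 !scale1r
  ?scale0r !addr0.
Qed.

Fact double_counitr i :
  \sum_(p <- double_comul i) pcounit p.2 *: p.1 = @pgen k double_pres i.
Proof.
by case: i; rewrite /= !big_cons !big_nil /= !pcounit_gen /= ?pcounit1 !scale1r
  ?scale0r ?add0r !addr0.
Qed.

Fact double_antipodel i :
  \sum_(p <- double_comul i) pantipodeD p.1 * p.2 = (double_aug i)%:A.
Proof.
have E j : pantipodeD (pgen j) = double_antipode j.
  exact: (@pantipodeE k double_pres _ double_antipode_rel).
case: i; rewrite /= !big_cons !big_nil /= !E
  ?(@pantipode1 k double_pres _ double_antipode_rel) /= ?addr0.
- by rewrite double_ggE scale1r.
- by rewrite double_GGE scale1r.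
- by rewrite mulr1 subrr scale0r.
- by rewrite mul1r mulNr -mulrA double_GGE mulr1 subrr scale0r.
Qed.

Fact double_antipoder i :
  \sum_(p <- double_comul i) p.1 * pantipodeD p.2 = (double_aug i)%:A.
Proof.
have E j : pantipodeD (pgen j) = double_antipode j.
  exact: (@pantipodeE k double_pres _ double_antipode_rel).
case: i; rewrite /= !big_cons !big_nil /= !E
  ?(@pantipode1 k double_pres _ double_antipode_rel) /= ?addr0.
- by rewrite double_ggE scale1r.
- by rewrite double_GGE scale1r.
- by rewrite mulr1 mulrN mulrA double_ggE mul1r addNr scale0r.
- by rewrite mul1r addNr scale0r.
Qed.

Definition sweedler_double : hopfAlg k :=
  @presented_hopf k double_pres double_comul double_antipode
    double_comul_rel double_antipode_rel double_coassoc
    double_counitl double_counitr double_antipodel double_antipoder.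

Lemma double_g_grouplike : grouplike (double_g : sweedler_double).
Proof.
split; last exact: (@pcomul_gen k double_pres _ double_comul_rel).
apply/eqP => g0; have /eqP := double_ggE.
by rewrite g0 mul0r eq_sym oner_eq0.
Qed.

Lemma double_G_grouplike : grouplike (double_G : sweedler_double).
Proof.
split; last exact: (@pcomul_gen k double_pres _ double_comul_rel).
apply/eqP => G0; have /eqP := double_GGE.
by rewrite G0 mul0r eq_sym oner_eq0.
Qed.

Lemma double_x_skew : skew_primitive (double_g : sweedler_double) 1 (double_x : sweedler_double).
Proof. exact: (@pcomul_gen k double_pres _ double_comul_rel). Qed.

Lemma double_X_skew : skew_primitive 1 (double_G : sweedler_double) (double_X : sweedler_double).
Proof. exact: (@pcomul_gen k double_pres _ double_comul_rel). Qed.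

Definition sweedler_double_gen (i : sweedler_gen) : double_alg :=
  match i with Sg => double_g | Sx => double_x end.

Fact sweedler_double_respects :
  respects (@sweedler_rel k) sweedler_double_gen.
Proof.
by move=> s t [] /=;
  rewrite ?scale1r ?scale0r ?scaleN1r ?mulN1r
    ?double_ggE ?double_xxE ?double_gxE.
Qed.

Definition sweedler_incl : sweedler k -> sweedler_double :=
  @plift k (sweedler_pres k) double_alg sweedler_double_gen.

Lemma sweedler_incl_g : sweedler_incl (sweedler_g k) = double_g.
Proof. exact: (@plift_pgen k (sweedler_pres k) _ _ sweedler_double_respects). Qed.
Lemma sweedler_incl_x : sweedler_incl (sweedler_x k) = double_x.
Proof. exact: (@plift_pgen k (sweedler_pres k) _ _ sweedler_double_respects). Qed.
Lemma sweedler_incl_linear : linear sweedler_incl.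
Proof. exact: (@plift_linear k (sweedler_pres k) _ _ sweedler_double_respects). Qed.
Lemma sweedler_incl1 : sweedler_incl 1 = 1.
Proof. exact: (@plift1 k (sweedler_pres k) _ _ sweedler_double_respects). Qed.
Lemma sweedler_inclM : {morph sweedler_incl : a b / a * b}.
Proof. exact: (@pliftM k (sweedler_pres k) _ _ sweedler_double_respects). Qed.

Lemma sweedler_incl_counit (h : sweedler k) :
  counit (sweedler_incl h) = counit h.
Proof.
have iL := sweedler_incl_linear.
elim/(@presented_ind k (sweedler_pres k)): h => [i|a|a b IHa IHb|a b IHa IHb].
- by case: i; rewrite ?sweedler_incl_g ?sweedler_incl_x /=
    [RHS](@pcounit_gen k (sweedler_pres k))
    [LHS](@pcounit_gen k double_pres).
- rewrite (linZ iL) sweedler_incl1 [RHS](@pcounit_scal k (sweedler_pres k)).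
  exact: (@pcounit_scal k double_pres).
- rewrite (linD iL) [RHS](@pcounitD k (sweedler_pres k)).
  by rewrite [LHS](@pcounitD k double_pres); congr (_ + _).
- by rewrite sweedler_inclM !counitM IHa IHb.
Qed.

Lemma sweedler_incl_comul (h : sweedler k) :
  teq (comul (sweedler_incl h))
      [seq (sweedler_incl p.1, sweedler_incl p.2) | p <- comul h].
Proof.
have iL := sweedler_incl_linear.
have mapE (W : lmodType k) (f : sweedler_double -> sweedler_double -> W) s :
    tapp f [seq (sweedler_incl p.1, sweedler_incl p.2) | p <- s] =
    tapp (fun a b => f (sweedler_incl a) (sweedler_incl b)) s.
  by rewrite /tapp big_map.
have incl_bil (W : lmodType k) (f : sweedler_double -> sweedler_double -> W) : bilinear_map f ->
    bilinear_map (fun a b : sweedler k => f (sweedler_incl a) (sweedler_incl b)).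
  by move=> [fl fr]; split=> u a b c; rewrite iL; [exact: fl | exact: fr].
have cS := @sweedler_comul_rel k; have cD := double_comul_rel.
elim/(@presented_ind k (sweedler_pres k)): h => [i|a|a b IHa IHb|a b IHa IHb] W f fB;
  have fB' := incl_bil W f fB; rewrite mapE.
- rewrite [RHS](@pcomul_gen k (sweedler_pres k) _ cS i) //.
  case: i; rewrite ?sweedler_incl_g ?sweedler_incl_x.
    rewrite [LHS](@pcomul_gen k double_pres _ cD Dg) // !tapp_cons !tapp_nil /=.
    by rewrite sweedler_incl_g.
  rewrite [LHS](@pcomul_gen k double_pres _ cD Dx) // !tapp_cons !tapp_nil /=.
  by rewrite sweedler_incl_g sweedler_incl_x sweedler_incl1.
- rewrite (linZ iL) sweedler_incl1.
  rewrite [LHS](@pcomul_scal k double_pres _ cD a) //.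
  rewrite [RHS](@pcomul_scal k (sweedler_pres k) _ cS a) // !tapp_cons !tapp_nil /=.
  by rewrite (linZ iL) sweedler_incl1.
- rewrite (linD iL) [LHS](@pcomulD k double_pres _ cD) //.
  rewrite [RHS](@pcomulD k (sweedler_pres k) _ cS) // !tapp_cat.
  by congr (_ + _); [rewrite -mapE; exact: IHa | rewrite -mapE; exact: IHb].
- rewrite sweedler_inclM comulM // [RHS]comulM // !tapp_mul.
  transitivity (tapp f (tmul
      [seq (sweedler_incl p.1, sweedler_incl p.2) | p <- @comul k (sweedler k) a]
      [seq (sweedler_incl p.1, sweedler_incl p.2) | p <- @comul k (sweedler k) b])).
    by rewrite -tapp_mul; apply: teq_mul.
  rewrite tapp_mul big_map; apply: eq_bigr => p _.
  by rewrite big_map; apply: eq_bigr => q _; rewrite !sweedler_inclM.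
Qed.

(* g, G |-> g, x |-> x, X |-> 0 is a retraction of sweedler_incl.             *)
Definition double_retr_gen (i : double_gen) : sweedler_alg k :=
  match i with
  | Dg | DG => sweedler_g k
  | Dx => sweedler_x k
  | DX => 0
  end.

Fact double_retr_respects : respects double_rel double_retr_gen.
Proof.
move=> s t [] /=;
  rewrite ?scale1r ?scale0r ?scaleN1r ?mulN1r ?mulr0 ?mul0r ?oppr0
    ?sweedler_ggE ?sweedler_xxE ?sweedler_gxE ?add0r ?subrr ?opprK //.
Qed.

Lemma sweedler_incl_inj : injective sweedler_incl.
Proof.
pose r := @plift k double_pres (sweedler_alg k) double_retr_gen.
suff rK : cancel sweedler_incl r by exact: can_inj rK.
have rL : linear r := @plift_linear k double_pres _ _ double_retr_respects.
have iL := sweedler_incl_linear.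
elim/(@presented_ind k (sweedler_pres k)) => [i|a|a b IHa IHb|a b IHa IHb].
- case: i; rewrite ?sweedler_incl_g ?sweedler_incl_x.
    exact: (@plift_pgen k double_pres _ _ double_retr_respects Dg).
  exact: (@plift_pgen k double_pres _ _ double_retr_respects Dx).
- rewrite (linZ iL) sweedler_incl1 (linZ rL); congr (_ *: _).
  exact: (@plift1 k double_pres _ _ double_retr_respects).
- by rewrite (linD iL) (linD rL); congr (_ + _).
- rewrite sweedler_inclM [LHS](@pliftM k double_pres _ _ double_retr_respects).
  by congr (_ * _).
Qed.

End Double.

Arguments sweedler_g {k}.
Arguments sweedler_x {k}.
Arguments double_g {k}.
Arguments double_G {k}.
Arguments double_x {k}.
Arguments double_X {k}.
Arguments sweedler_incl {k}.

Section QuadraticAlgebra.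
Variable k : fieldType.

Definition quad_alg : algType k := {poly %/ ('X^2 - 1 : {poly k})}.
Definition quad_u : quad_alg := 'qX.

(* {poly %/ p} is the quotient by mk_monic p, which here is p itself.        *)
Lemma mk_monic_quad : mk_monic ('X^2 - 1 : {poly k}) = 'X^2 - 1.
Proof.
have sz : (size (- (1 : {poly k})) < size ('X^2 : {poly k}))%N.
  by rewrite size_polyN size_poly1 size_polyXn.
rewrite /mk_monic size_polyDl // size_polyXn /=.
by rewrite monicE lead_coefDl // lead_coefXn eqxx.
Qed.

Lemma quad_uu : quad_u * quad_u = 1.
Proof.
rewrite /quad_u /qpolyX -in_qpolyM -in_qpoly1; apply/val_inj => /=.
rewrite mk_monic_quad -expr2.
have m : 'X^2 - 1 \is @monic k by rewrite -mk_monic_quad monic_mk_monic.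
have -> : Pdiv.Ring.rmodp 'X^2 ('X^2 - 1 : {poly k}) =
    Pdiv.Ring.rmodp ('X^2 - 1 + 1) ('X^2 - 1) by rewrite subrK.
by rewrite Pdiv.RingMonic.rmodpD // Pdiv.RingMonic.rmodpp // add0r.
Qed.

End QuadraticAlgebra.

(* Main.v *)
(* A is 2-dimensional, so the extension by delta is a representation of the
   double by 2 x 2 matrices in the basis (1, u), and the module algebra axioms
   need only be checked on generators.  Conversely, (G u)^2 = G (u^2) = 1 forces
   the two coordinates of G u to have product 0, and applying xG = - Gx to u
   forces its u-coordinate to be -1, as gamma != 0; then G u = - u.  Applying
   gX = - Xg to u shows that X u is g-invariant, hence a scalar. *)

Require Import Defs.
From mathcomp Require Import all_boot all_order all_algebra.
From mathcomp Require Import qpoly ring.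

Set Implicit Arguments.
Unset Strict Implicit.

Import GRing.Theory.
Local Open Scope ring_scope.

(** * Actions checked on generators *)

(** Generation is phrased as an induction principle, the form in which [presented_ind] provides
    it. *)
Definition generates (k : fieldType) (B : algType k) (I : Type) (e : I -> B) :=
  forall Q : B -> Prop, (forall i, Q (e i)) -> (forall a : k, Q a%:A) ->
  (forall x y, Q x -> Q y -> Q (x + y)) ->
  (forall x y, Q x -> Q y -> Q (x * y)) -> forall h, Q h.

(** The elements on which two actions agree contain the scalars and are closed under sums and
    products. *)
Lemma action_ext (k : fieldType) (B : algType k) (V : lmodType k) (I : Type)
    (e : I -> B) (act act' : B -> V -> V) : generates e ->
  bilinear_map act -> (forall v, act 1 v = v) ->
  (forall h h' v, act (h * h') v = act h (act h' v)) ->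
  bilinear_map act' -> (forall v, act' 1 v = v) ->
  (forall h h' v, act' (h * h') v = act' h (act' h' v)) ->
  (forall i v, act (e i) v = act' (e i) v) ->
  forall h v, act h v = act' h v.
Proof.
move=> gen /bilin_l al a1 aM /bilin_l al' a1' aM' ee.
elim/gen => [//|a|x y IHx IHy|x y IHx IHy] v.
- by rewrite (linZ (al v)) (linZ (al' v)) a1 a1'.
- by rewrite (linD (al v)) (linD (al' v)) IHx IHy.
- by rewrite aM aM' IHx IHy.
Qed.

Section ModuleAlgebra.
Variables (k : fieldType) (H : hopfAlg k) (A : algType k) (act : H -> A -> A).
Hypothesis act_bil : bilinear_map act.
Let al := bilin_l act_bil.
Let ar := bilin_r act_bil.

Lemma act_prod_bilinear a b : bilinear_map (fun h h' => act h a * act h' b).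
Proof.
split=> h c x y /=; rewrite (linP (al _)).
  by rewrite mulrDl scalerAl.
by rewrite mulrDr scalerAr.
Qed.

(** A coproduct is a list known only up to [teq]; bilinearity of the summand lets any list denoting
    the same tensor replace it. *)
Lemma act_comul h (t : tensor H H) a b : teq (comul h) t ->
  \sum_(p <- comul h) act p.1 a * act p.2 b = \sum_(p <- t) act p.1 a * act p.2 b.
Proof. by move=> ht; exact: ht (act_prod_bilinear a b). Qed.

Lemma act_comul_linear a b :
  linear (fun h => \sum_(p <- comul h) act p.1 a * act p.2 b).
Proof.
move=> c x y; have fB := act_prod_bilinear a b.
rewrite (act_comul _ _ (comulP c x y)).
rewrite -[LHS]/(tapp (fun h h' => act h a * act h' b) _).
by rewrite tapp_cat tapp_scale.
Qed.

Hypothesis act_id : forall a, act 1 a = a.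
Hypothesis act_comp : forall h h' a, act (h * h') a = act h (act h' a).

(** The elements obeying the product rule form a subalgebra: both sides are linear in [h], [comul]
    is multiplicative and the action composes. The same holds for the rule on [1], as [counit] is an
    algebra map. *)
Lemma module_algebra_gen (I : Type) (e : I -> H) : generates e ->
  (forall i a b,
     act (e i) (a * b) = \sum_(p <- comul (e i)) act p.1 a * act p.2 b) ->
  (forall i, act (e i) 1 = (counit (e i))%:A) ->
  module_algebra act.
Proof.
move=> gen eM e1.
have eL : linear (@counit k H : H -> k^o) by exact: counitP.
split=> //.
- elim/gen=> [//|c|x y IHx IHy|x y IHx IHy] a b.
  + rewrite (linZ (al _)) (linZ (act_comul_linear a b)) act_id.
    by rewrite (act_comul _ _ (@comul1 k H)) big_seq1 !act_id.
  + by rewrite (linD (al _)) (linD (act_comul_linear a b)) IHx IHy.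
  + rewrite act_comp IHy (lin_sum (ar _)).
    rewrite (act_comul _ _ (comulM x y)) -[RHS]/(tapp (fun h h' => act h a * act h' b) _).
    (* As [y] acts first, the left side has the sum over [comul y] outermost. *)
    rewrite tapp_mul exchange_big /=.
    apply: eq_bigr => q _; rewrite IHx.
    by apply: eq_bigr => p _; rewrite !act_comp.
- elim/gen=> [//|c|x y IHx IHy|x y IHx IHy].
  + rewrite (linZ (al _)) act_id (linZ eL) counit1; congr (_ *: 1).
    exact/esym/mulr1.
  + by rewrite (linD (al _)) (linD eL) scalerDl IHx IHy.
  + by rewrite act_comp IHy (linZ (ar _)) IHx counitM scalerA mulrC.
Qed.

End ModuleAlgebra.

(** * Coordinates of A in the basis (1, u) *)

Section QuadraticAlgebraBasis.
Variable k : fieldType.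

Definition quad (a b : k) : quad_alg k := a%:A + b *: quad_u k.
(** Residue classes are stored as reduced polynomials, so coordinates are coefficients. *)
Definition quad_coord (z : quad_alg k) (i : nat) : k := (z : {poly k})`_i.

Lemma quad_u_poly : quad_u k = 'X :> {poly k}.
Proof.
apply: qpolyXE; last by rewrite -mk_monic_quad monic_mk_monic.
by rewrite size_polyDl size_polyXn // size_polyN size_poly1.
Qed.

Lemma quad_poly a b : quad a b = a%:P + b *: 'X :> {poly k}.
Proof. by rewrite -alg_polyC -[in RHS]quad_u_poly poly_of_qpolyD. Qed.

Lemma quad_coord0 a b : quad_coord (quad a b) 0 = a.
Proof. by rewrite /quad_coord quad_poly coefD coefZ coefX coefC /= mulr0 addr0. Qed.

Lemma quad_coord1 a b : quad_coord (quad a b) 1 = b.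
Proof. by rewrite /quad_coord quad_poly coefD coefZ coefX coefC /= mulr1 add0r. Qed.

Lemma quad_inj a b c d : quad a b = quad c d -> a = c /\ b = d.
Proof.
by move=> e; split; [have := congr1 (quad_coord^~ 0) e
  | have := congr1 (quad_coord^~ 1) e]; rewrite ?quad_coord0 ?quad_coord1.
Qed.

Lemma quad_coordP c x y i :
  quad_coord (c *: x + y) i = c * quad_coord x i + quad_coord y i.
Proof. by rewrite /quad_coord poly_of_qpolyD /= coefD coefZ. Qed.

(** The reduced representative has degree at most 1, so no coefficient beyond the first two
    survives. *)
Lemma quad_eta z : z = quad (quad_coord z 0) (quad_coord z 1).
Proof.
apply/val_inj; apply: etrans (esym (quad_poly _ _)); apply/polyP=> i /=.
rewrite coefD coefZ coefC coefX.
case: i => [|[|i]]; rewrite /= ?mulr0 ?mulr1 ?addr0 ?add0r //.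
have sz : size (mk_monic ('X^2 - 1 : {poly k})) = 3.
  by rewrite mk_monic_quad size_polyDl size_polyXn ?size_polyN ?size_poly1.
have := size_mk_monic z; rewrite [X in (_ < X)%N]sz ltnS => zs.
by apply: nth_default; exact: leq_trans zs _.
Qed.

Lemma quadM a b c d : quad a b * quad c d = quad (a * c + b * d) (a * d + b * c).
Proof.
rewrite /quad mulrDl !mulrDr -!scalerAl -!scalerAr !mul1r quad_uu !scalerA.
by rewrite !scalerDl mulr1 [X in _ + X = _]addrC addrACA.
Qed.

Lemma quadD a b c d : quad a b + quad c d = quad (a + c) (b + d).
Proof. by rewrite /quad !scalerDl addrACA. Qed.

Lemma quadZ c a b : c *: quad a b = quad (c * a) (c * b).
Proof. by rewrite /quad scalerDr !scalerA. Qed.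

(** As [h] acts on [1] by the counit, an action on A is determined by its values on u. *)
Lemma module_algebra_quad (H : hopfAlg k) (act : H -> quad_alg k -> quad_alg k) :
  module_algebra act -> forall h a b,
  act h (quad a b) = (a * counit h)%:A + b *: act h (quad_u k).
Proof.
move=> [aB _ _ _ a1] h a b; have ar := bilin_r aB h.
by rewrite /quad (linD ar) !(linZ ar) a1 scalerA.
Qed.

End QuadraticAlgebraBasis.

(** * 2 x 2 matrices acting on A *)

Section QuadraticMatrixAction.
Variable k : fieldType.

Definition mat2 (a b c d : k) : 'M[k]_2 :=
  \matrix_(i, j) (nth [::] [:: [:: a; b]; [:: c; d]] i)`_j.

Lemma mat2M a b c d a' b' c' d' : mat2 a b c d * mat2 a' b' c' d' =
  mat2 (a * a' + b * c') (a * b' + b * d') (c * a' + d * c') (c * b' + d * d').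
Proof.
apply/matrixP=> i j; rewrite !mxE !big_ord_recl big_ord0 !mxE /= addr0.
by case: i j => [[|[|//]] ?] [[|[|//]] ?].
Qed.

Lemma mat2_1 : 1 = mat2 1 0 0 1.
Proof.
by apply/matrixP=> i j; rewrite !mxE; case: i j => [[|[|//]] ?] [[|[|//]] ?].
Qed.

Lemma mat2Z e a b c d : e *: mat2 a b c d = mat2 (e * a) (e * b) (e * c) (e * d).
Proof.
by apply/matrixP=> i j; rewrite !mxE; case: i j => [[|[|//]] ?] [[|[|//]] ?].
Qed.

Lemma mat2D a b c d a' b' c' d' :
  mat2 a b c d + mat2 a' b' c' d' = mat2 (a + a') (b + b') (c + c') (d + d').
Proof.
by apply/matrixP=> i j; rewrite !mxE; case: i j => [[|[|//]] ?] [[|[|//]] ?].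
Qed.

(** Coordinates form column vectors: the columns of [M] are the images of 1 and u. *)
Definition quad_act (M : 'M[k]_2) (z : quad_alg k) : quad_alg k :=
  quad (M 0 0 * quad_coord z 0 + M 0 1 * quad_coord z 1)
       (M 1 0 * quad_coord z 0 + M 1 1 * quad_coord z 1).

Lemma quad_act_mat2 a b c d p q :
  quad_act (mat2 a b c d) (quad p q) = quad (a * p + b * q) (c * p + d * q).
Proof. by rewrite /quad_act quad_coord0 quad_coord1 !mxE. Qed.

Lemma quad_act_bilinear : bilinear_map quad_act.
Proof.
split=> [z a M N|M a y z] /=; rewrite /quad_act quadZ quadD.
  by rewrite !mxE; congr quad; ring.
by rewrite !quad_coordP; congr quad; ring.
Qed.

Lemma quad_act1 z : quad_act 1 z = z.
Proof.
by rewrite /quad_act !mxE /= !mul1r !mul0r addr0 add0r -quad_eta.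
Qed.

Lemma quad_actM M N z : quad_act (M * N) z = quad_act M (quad_act N z).
Proof.
rewrite /quad_act quad_coord0 quad_coord1 !mxE !big_ord_recl !big_ord0.
have -> : lift ord0 ord0 = 1 :> 'I_2 by exact/val_inj.
by congr quad; ring.
Qed.

End QuadraticMatrixAction.

Lemma presented_generates (k : fieldType) (P : presentation k) :
  generates (@pgen k P : _ -> presented P).
Proof. exact: presented_ind. Qed.

(** * The extension with parameter delta *)

Section DoubleAction.
Variables (k : fieldType) (gamma delta : k).

Definition double_mat (i : double_gen) : 'M[k]_2 :=
  match i with
  | Dg | DG => mat2 1 0 0 (- 1)
  | Dx => mat2 0 gamma 0 0
  | DX => mat2 0 delta 0 0
  end.

(** The matrices of x and X are multiples of one square-zero matrix, which anticommutes with the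
    common matrix of g and G. Hence xX and Xx both vanish, as does G - g. *)
Fact double_mat_respects : respects (@double_rel k) double_mat.
Proof.
by move=> s t []; rewrite /= ?mat2_1 ?mat2Z ?mat2M ?mat2Z ?mat2D ?mat2M ?mat2D; congr mat2; ring.
Qed.

Definition double_act (h : sweedler_double k) (z : quad_alg k) : quad_alg k :=
  quad_act (@plift k (double_pres k) 'M[k]_2 double_mat h) z.

Lemma double_act_gen i z :
  double_act (@pgen k (double_pres k) i) z = quad_act (double_mat i) z.
Proof. by rewrite /double_act (@plift_pgen k (double_pres k) _ _ double_mat_respects). Qed.

Lemma double_act_bilinear : bilinear_map double_act.
Proof.
have [ql qr] := quad_act_bilinear k.
split=> [z a x y|h]; last exact: qr.
rewrite /= /double_act (@plift_linear k (double_pres k) _ _ double_mat_respects a x y); exact: ql.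
Qed.

Lemma double_act1 z : double_act 1 z = z.
Proof. by rewrite /double_act (@plift1 k (double_pres k) _ _ double_mat_respects) quad_act1. Qed.

Lemma double_actM h h' z : double_act (h * h') z = double_act h (double_act h' z).
Proof. by rewrite /double_act (@pliftM k (double_pres k) _ _ double_mat_respects) quad_actM. Qed.

Lemma double_act_module_algebra : module_algebra double_act.
Proof.
have aB := double_act_bilinear.
apply: (@module_algebra_gen k (sweedler_double k) _ _ aB double_act1 double_actM
  _ _ (@presented_generates k (double_pres k))).
  move=> i a b.
  rewrite (act_comul aB _ _ (@pcomul_gen k (double_pres k) _ (@double_comul_rel k) i)).
  rewrite (quad_eta a) (quad_eta b) quadM.
  case: i; rewrite /= ?big_cons big_nil /= ?double_act1 !double_act_gen !quad_act_mat2
    ?quadM ?quadD addr0 ?quadD; congr quad; ring.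
have q1 : 1 = quad 1 0 :> quad_alg k by rewrite /quad scale1r scale0r addr0.
move=> i; rewrite double_act_gen [counit _](@pcounit_gen k (double_pres k)) q1 quadZ.
by case: i; rewrite /= quad_act_mat2; congr quad; ring.
Qed.

End DoubleAction.

(** * Existence and classification of the extensions *)

Theorem proposition3p4 (k : closedFieldType) (char0 : [pchar k] =i pred0)
    (gamma : k) (gamma_neq0 : gamma != 0)
    (actT : sweedler k -> quad_alg k -> quad_alg k)
    (actT_mod : module_algebra actT)
    (actT_g : actT sweedler_g (quad_u k) = - quad_u k)
    (actT_x : actT sweedler_x (quad_u k) = gamma%:A) :
  (forall delta : k,
     exists actD : sweedler_double k -> quad_alg k -> quad_alg k,
       [/\ module_algebra actD,
           forall h a, actD (sweedler_incl h) a = actT h a,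
           actD double_G (quad_u k) = - quad_u k
         & actD double_X (quad_u k) = delta%:A])
  /\
  (forall actD : sweedler_double k -> quad_alg k -> quad_alg k,
     module_algebra actD ->
     (forall h a, actD (sweedler_incl h) a = actT h a) ->
     exists delta : k,
       actD double_G (quad_u k) = - quad_u k /\
       actD double_X (quad_u k) = delta%:A).
Proof.
have uE : quad_u k = quad 0 1 by rewrite /quad scale0r scale1r add0r.
have cE (c : k) : c%:A = quad c 0 by rewrite /quad scale0r addr0.
split=> [delta|actD D_mod DT].
  have aB := double_act_bilinear gamma delta.
  exists (double_act gamma delta); split.
  - exact: double_act_module_algebra.
  - have [TB T1 TM _ _] := actT_mod.
    have iL := @sweedler_incl_linear k.
    apply: (action_ext (@presented_generates k (sweedler_pres k))
      (act := fun h a => double_act gamma delta (sweedler_incl h) a) _ _ _ TB T1 TM).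
    + case: aB => l r; split=> [z a x y|h]; last exact: r.
      by rewrite /= iL; exact: l.
    + by move=> z; rewrite sweedler_incl1 double_act1.
    + by move=> h h' z; rewrite sweedler_inclM double_actM.
    (* On g and x the given action is known from its values on u and the counit; these match the
       matrices. *)
    move=> i z; rewrite (quad_eta z) (module_algebra_quad actT_mod).
    rewrite [counit _](@pcounit_gen k (sweedler_pres k)).
    case: i; rewrite ?sweedler_incl_g ?sweedler_incl_x ?actT_g ?actT_x
      double_act_gen /= quad_act_mat2 cE -?(scaleN1r (quad_u k)) ?uE ?cE !quadZ quadD;
      congr quad; ring.
  - by rewrite double_act_gen uE quad_act_mat2 -scaleN1r quadZ; congr quad; ring.
  - by rewrite double_act_gen uE quad_act_mat2 cE; congr quad; ring.
have [DB D1 DM Dmul Done] := D_mod; have Dl := bilin_l DB; have Dr := bilin_r DB.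
have DE h a b : actD h (quad a b) = (a * counit h)%:A + b *: actD h (quad_u k).
  exact: module_algebra_quad.
have eps i : counit (@pgen k (double_pres k) i : sweedler_double k) = double_aug k i.
  exact: (@pcounit_gen k (double_pres k)).
have Dg_u : actD double_g (quad_u k) = - quad_u k by rewrite -sweedler_incl_g DT.
have Dx_u : actD double_x (quad_u k) = gamma%:A by rewrite -sweedler_incl_x DT.
(* Characteristic 0 makes 2 invertible. *)
have two_inj (a : k) : a + a = 0 -> a = 0.
  move/eqP; rewrite -mulr2n -mulr_natl mulf_eq0 => /orP[|/eqP //].
  by rewrite (pcharf0P k).1.
have [a [b DG_u]] : exists a b, actD double_G (quad_u k) = quad a b.
  by eexists; eexists; exact: quad_eta.
have [c [d DX_u]] : exists c d, actD double_X (quad_u k) = quad c d.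
  by eexists; eexists; exact: quad_eta.
(* Compare the coordinates of G(u^2) = 1 and (G u)^2; the u-coordinate gives 2ab = 0. *)
have [_ ab] : 1 = a * a + b * b /\ 0 = a * b + b * a.
  apply: quad_inj; rewrite -quadM -DG_u.
  transitivity (actD double_G (quad_u k * quad_u k)).
    by rewrite quad_uu Done eps cE.
  rewrite Dmul (act_comul DB _ _ (@pcomul_gen k (double_pres k) _ (@double_comul_rel k) DG)).
  by rewrite big_seq1.
(* Since x kills 1 and G fixes it, xG u = b gamma and -Gx u = - gamma. *)
have b1 : b = - 1.
  have : actD (double_x * double_G) (quad_u k) = actD (- (double_G * double_x)) (quad_u k).
    by rewrite double_xGE.
  rewrite (linN (Dl _)) !DM DG_u Dx_u DE Dx_u cE DE !eps /=.
  rewrite !cE -scaleN1r scale0r addr0 !quadZ quadD => /quad_inj[e _].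
  by apply: (mulIf gamma_neq0); move: e; rewrite !mulr0 !mulr1 add0r mulN1r => ->.
have a0 : a = 0.
  by apply: two_inj; apply: oppr_inj; rewrite oppr0 ab b1 mulrN1 mulN1r opprD.
(* Here gX u = c - d u, while -Xg u = X u = c + d u. *)
have d0 : d = 0.
  apply: two_inj.
  have : actD (double_g * double_X) (quad_u k) = actD (- (double_X * double_g)) (quad_u k).
    by rewrite double_gXE.
  rewrite (linN (Dl _)) !DM DX_u Dg_u DE Dg_u (linN (Dr _)) DX_u opprK eps /=.
  rewrite cE -(scaleN1r (quad_u k)) uE !quadZ quadD => /quad_inj[_ /esym dE].
  by rewrite {1}dE; ring.
exists c; rewrite DG_u DX_u a0 b1 d0 cE; split=> //.
by rewrite uE -scaleN1r quadZ mulr0 mulr1.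
Qed.
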